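(* Let $\Omega\subset\mathbb{R}^d$ be an open set containing $0$, let $k:\Omega\times\Omega\to\mathbb{R}^{m\times m}$ be a twice continuously differentiable positive definite matrix-valued kernel with native space $\mathcal{H}$, let $x_1,\dots,x_N\in\Omega$, $y_1,\dots,y_N\in\mathbb{R}^m$, and let $\omega_1,\dots,\omega_N\in\mathbb{R}^{m\times m}$ be symmetric positive definite matrices. Then the minimization problem $$\min_{s\in\mathcal{H}}\ J(s)=\|s\|_{\mathcal{H}}^2+\sum_{i=1}^N(s(x_i)-y_i)^T\omega_i(s(x_i)-y_i)\quad\text{subject to}\quad s(0)=0,\ \ Ds(0)=0$$ has a unique solution $\hat h\in\mathcal{H}$, which can be represented as $$\hat h(x)=\sum_{i=1}^{N+1}k(x,x_i)\alpha_i+\sum_{i=1}^d\partial_i^{(2)}k(x,0)\beta_i,$$ where $x_{N+1}:=0$ and $\alpha_i,\beta_i\in\mathbb{R}^m$. Moreover, the coefficient vectors $\alpha_1,\dots,\alpha_{N+1},\beta_1,\dots,\beta_d$ can be computed by solving the linear system $$\begin{pmatrix} A+W & B \\ B^T & C \end{pmatrix} \begin{pmatrix} \boldsymbol{\alpha} \\ \boldsymbol{\beta} \end{pmatrix} = \begin{pmatrix} \boldsymbol{Y} \\ \boldsymbol{Z} \end{pmatrix}$$ (that is, this system is solvable and inserting a solution in the representation above yields $\hat h$), where $\boldsymbol\alpha\in\mathbb{R}^{m(N+1)}$ and $\boldsymbol\beta\in\mathbb{R}^{dm}$ are the stacked vectors of the $\alpha_i$ and the $\beta_i$, and $$A:=\left(k(x_i,x_j)\right)_{i,j=1}^{N+1}\in\mathbb{R}^{m(N+1)\times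 m(N+1)},\qquad W:=\mathrm{diag}\left(\omega_1^{-1},\dots,\omega_N^{-1},0\right)\in\mathbb{R}^{m(N+1)\times m(N+1)},$$ $$B:=\left(\partial_j^{(2)}k(x_i,0)\right)_{1\le i\le N+1,\,1\le j\le d}\in\mathbb{R}^{m(N+1)\times dm},\qquad C:=\left(\partial_i^{(1)}\partial_j^{(2)}k(0,0)\right)_{i,j=1}^d\in\mathbb{R}^{dm\times dm},$$ $$\boldsymbol{Y}:=(y_1^T,\dots,y_N^T,0)^T\in\mathbb{R}^{m(N+1)},\qquad \boldsymbol{Z}:=0\in\mathbb{R}^{dm}.$$
   Context: A positive definite matrix-valued kernel on $\Omega$ is a function $k:\Omega\times\Omega\to\mathbb{R}^{m\times m}$ such that $k(x,y)=k(y,x)^T$ for all $x,y\in\Omega$, and for every $N\in\mathbb{N}$ and every set of pairwise distinct points $\{x_1,\dots,x_N\}\subset\Omega$ the block matrix $(k(x_i,x_j))_{i,j=1}^N\in\mathbb{R}^{mN\times mN}$ is positive semidefinite. Its native space $\mathcal{H}$ is the unique Hilbert space of functions $\Omega\to\mathbb{R}^m$ in which $k$ is reproducing: for all $x\in\Omega$ and $\alpha\in\mathbb{R}^m$, $k(\cdot,x)\alpha\in\mathcal{H}$ and $\langle f,k(\cdot,x)\alpha\rangle_{\mathcal{H}}=\alpha^Tf(x)$ for all $f\in\mathcal{H}$. $\partial_i^{(1)}$ and $\partial_i^{(2)}$ denote the partial derivative with respect to the $i$-th coordinate of the first, respectively second, argument of $k$; $Ds$ is the Jacobian of $s$; $\mathrm{diag}$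 denotes a block diagonal matrix. *)

(* Defs.v *)
From HB Require Import structures.
From mathcomp Require Export all_boot all_order all_algebra.
From mathcomp Require Export all_classical all_reals all_analysis.

Set Implicit Arguments.
Unset Strict Implicit.
Unset Printing Implicit Defensive.

Export Order.TTheory GRing.Theory Num.Theory.
Export numFieldNormedType.Exports.

Local Open Scope classical_set_scope.
Local Open Scope ring_scope.

Definition possemidefmx (R : realType) n (A : 'M[R]_n) : Prop :=
  A^T = A /\ forall v : 'cV[R]_n, 0 <= (v^T *m A *m v) 0 0.

Definition posdefmx (R : realType) n (A : 'M[R]_n) : Prop :=
  A^T = A /\ forall v : 'cV[R]_n, v != 0 -> 0 < (v^T *m A *m v) 0 0.

(* For finite-dimensional V, and U open, this is the usual class C^n on U:
   the directional derivatives 'D_v f are linear combinations of the partial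
   derivatives. *)
Fixpoint class_C (R : realType) (V W : normedModType R) (n : nat)
    (U : set V) (f : V -> W) : Prop :=
  if n is n'.+1 then
    (forall p, U p -> differentiable f p) /\
    (forall v, class_C n' U ('D_v f))
  else forall p, U p -> {for p, continuous f}.

Definition hnorm (R : realType) (E : lmodType R) (ip : E -> E -> R) (f : E) : R :=
  Num.sqrt (ip f f).

(* A Hilbert space sitting as a linear subspace H in an ambient real vector
   space E; the values of ip outside H are irrelevant. *)
Record hilbert_space (R : realType) (E : lmodType R) (H : set E)
    (ip : E -> E -> R) : Prop := HilbertSpace {
  hilbert0 : H 0;
  hilbertP : forall a f g, H f -> H g -> H (a *: f + g);
  hilbert_ipC : forall f g, H f -> H g -> ip f g = ip g f;
  hilbert_ipP : forall a f g h, H f -> H g -> H h ->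
    ip (a *: f + g) h = a * ip f h + ip g h;
  hilbert_ip_ge0 : forall f, H f -> 0 <= ip f f;
  hilbert_ip_eq0 : forall f, H f -> ip f f = 0 -> f = 0;
  hilbert_complete : forall u : nat -> E, (forall n, H (u n)) ->
    (forall e : R, 0 < e -> \forall p & q \near \oo, hnorm ip (u p - u q) < e) ->
    exists2 f, H f & hnorm ip (u n - f) @[n --> \oo] --> 0 }.

Section Kernels.
Variables (R : realType) (d m : nat).
Implicit Types (Omega : set 'cV[R]_d) (k : 'cV[R]_d -> 'cV[R]_d -> 'M[R]_m).

(* Kernels on Omega are total functions of which only the values on
   Omega x Omega matter. *)
Definition posdef_kernel Omega k : Prop :=
  (forall x y, Omega x -> Omega y -> k x y = (k y x)^T) /\
  (forall (n : nat) (x : 'I_n -> 'cV[R]_d),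
     injective x -> (forall i, Omega (x i)) ->
     possemidefmx (\mxblock_(i < n, j < n) k (x i) (x j))).

(* The function k(., x) a, extended by 0 outside Omega. *)
Definition ksection Omega k (x : 'cV[R]_d) (a : 'cV[R]_m) :
    'cV[R]_d -> 'cV[R]_m :=
  patch (fun=> 0) Omega (fun y => k y x *m a).

(* Functions Omega -> R^m are represented by their extensions by 0 to R^d, so
   that Leibniz equality is equality of functions on Omega.  The native space
   of a positive definite kernel exists and is unique, so a statement about it
   is a statement about every (H, ip) satisfying this predicate. *)
Record native_space Omega k (H : set ('cV[R]_d -> 'cV[R]_m))
    (ip : ('cV[R]_d -> 'cV[R]_m) -> ('cV[R]_d -> 'cV[R]_m) -> R) : Prop :=
  NativeSpace {
  native_hilbert : hilbert_space H ip;
  native_dom : forall f, H f -> forall x, ~ Omega x -> f x = 0;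
  native_section : forall x (a : 'cV[R]_m), Omega x ->
    H (ksection Omega k x a);
  native_reproducing : forall f x (a : 'cV[R]_m), H f -> Omega x ->
    ip f (ksection Omega k x a) = (a^T *m f x) 0 0 }.

Definition stdvec (i : 'I_d) : 'cV[R]_d := delta_mx i 0.

Definition partial1 k (i : 'I_d) (x y : 'cV[R]_d) : 'M[R]_m :=
  'D_(stdvec i) (fun x' => k x' y) x.

Definition partial2 k (i : 'I_d) (x y : 'cV[R]_d) : 'M[R]_m :=
  'D_(stdvec i) (fun y' => k x y') y.

(* mathcomp-analysis's 'J is only available for maps between row vectors. *)
Definition Jacobian (s : 'cV[R]_d -> 'cV[R]_m) (x : 'cV[R]_d) : 'M[R]_(m, d) :=
  \matrix_(i < m, j < d) ('D_(stdvec j) s x) i 0.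

End Kernels.

(* The family (f_1, ..., f_n, a). *)
Definition add_last (T : Type) n (f : 'I_n -> T) (a : T) (i : 'I_n.+1) : T :=
  oapp f a (unlift ord_max i).

Section Problem.
Variables (R : realType) (d m N : nat).
Variables (k : 'cV[R]_d -> 'cV[R]_d -> 'M[R]_m).
Variables (H : set ('cV[R]_d -> 'cV[R]_m)).
Variables (ip : ('cV[R]_d -> 'cV[R]_m) -> ('cV[R]_d -> 'cV[R]_m) -> R).
Variables (x : 'I_N -> 'cV[R]_d) (y : 'I_N -> 'cV[R]_m) (w : 'I_N -> 'M[R]_m).

Definition cost (s : 'cV[R]_d -> 'cV[R]_m) : R :=
  hnorm ip s ^+ 2
  + \sum_(i < N) ((s (x i) - y i)^T *m w i *m (s (x i) - y i)) 0 0.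

Definition feasible (s : 'cV[R]_d -> 'cV[R]_m) : Prop :=
  [/\ H s, s 0 = 0, differentiable s 0 & Jacobian s 0 = 0].

Definition is_minimizer (s : 'cV[R]_d -> 'cV[R]_m) : Prop :=
  feasible s /\ forall t, feasible t -> cost s <= cost t.

Definition centers : 'I_N.+1 -> 'cV[R]_d := add_last x 0.

Definition ansatz (a : 'I_N.+1 -> 'cV[R]_m) (b : 'I_d -> 'cV[R]_m)
    (z : 'cV[R]_d) : 'cV[R]_m :=
  \sum_(i < N.+1) k z (centers i) *m a i + \sum_(i < d) partial2 k i z 0 *m b i.

Definition mxA := \mxblock_(i < N.+1, j < N.+1) k (centers i) (centers j).

Definition mxW :=
  \mxdiag_(i < N.+1) add_last (fun j => invmx (w j)) (0 : 'M[R]_m) i.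

Definition mxB := \mxblock_(i < N.+1, j < d) partial2 k j (centers i) 0.

Definition mxC :=
  \mxblock_(i < d, j < d) partial1 (fun u v => partial2 k j u v) i 0 0.

Definition vecY := \mxcol_(i < N.+1) add_last y 0 i.

Definition solves_system (a : 'I_N.+1 -> 'cV[R]_m) (b : 'I_d -> 'cV[R]_m) :
    Prop :=
  block_mx (mxA + mxW) mxB mxB^T mxC
    *m col_mx (\mxcol_(i < N.+1) a i) (\mxcol_(i < d) b i)
  = col_mx vecY 0.

End Problem.

(* Main.v *)
From HB Require Import structures.
Require Import Defs.
From mathcomp Require Import ring lra.

(** Only finitely many continuous linear functionals on the native space enter
the problem: the evaluations [f |-> a^T f(x_i)], where [x_(N+1) = 0], and the
derivatives [f |-> b^T (d_j f)(0)].  The evaluations are represented by the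
sections [k(., x_i) a], by the reproducing property.  The derivatives are
represented by [z |-> (d_j^(2) k)(z, 0) b]; this is
[derivative_representer], the analytic heart of the proof.  There the
difference quotients of [z |-> k(., z) b] at [0] are shown to form a Cauchy
sequence: their inner products are second order difference quotients of the
kernel, which converge because the kernel is twice continuously differentiable
([kernel_second_difference], by applying the mean value theorem twice).  A weak
limit then exists ([gram_limit]), and testing it against the sections of the
kernel identifies it.

Let [h] be the combination of these representers with coefficients [alpha] and
[beta].  Since inner products of representers are entries of [A], [B] and [C],
the system says nothing but
[h(x_i) + w_i^-1 alpha_i = y_i], [h(0) = 0] and [Dh(0) = 0]
([solves_systemP]), and its quadratic form at [(alpha, beta)] is
[|h|^2 + sum_i alpha_i^T w_i^-1 alpha_i] ([system_form]).

Solvability ([system_solvable]): a vector on which the quadratic form vanishes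
has [alpha_i = 0] for [i <= N], so that it is orthogonal to the right hand side
[(Y, 0)], which is supported on these blocks.

Optimality ([cost_feasible]): for a solution, [w_i (h(x_i) - y_i) = - alpha_i].
For every feasible [t], put [u = t - h]; as [u] and its derivatives vanish at
[0], the inner product of [u] and [h] is [sum_i alpha_i^T u(x_i)], so that the
terms linear in [u] cancel in the expansion of the cost at [h + u] and
[J(t) = J(h) + |u|^2 + sum_i u(x_i)^T w_i u(x_i)].  Hence [h] is the only
minimizer, whichever solution of the system it was built from. *)

Set Implicit Arguments.
Unset Strict Implicit.
Unset Printing Implicit Defensive.

Local Open Scope classical_set_scope.
Local Open Scope ring_scope.

(** * Derivatives, linear maps and difference quotients *)

(** A linear map is the combination of the coordinates of its argument whose
coefficients are its values at the elementary matrices. *)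
Lemma linear_mx_continuous (R : realType) p q (W : normedModType R)
    (f : {linear 'M[R]_(p, q) -> W}) : continuous f.
Proof.
have -> : (f : _ -> _) = fun N : 'M[R]_(p, q) =>
    \sum_(ij : 'I_p * 'I_q) N ij.1 ij.2 *: f (delta_mx ij.1 ij.2).
  apply/funext => N; rewrite [X in f X]matrix_sum_delta pair_bigA /= linear_sum.
  by apply: eq_bigr => ij _; rewrite linearZ.
have coordc i j : continuous (fun N : 'M[R]_(p, q) => N i j : R).
  exact: coord_continuous.
apply: continuous_big => [|ij _]; first exact: add_continuous.
move: (coordc ij.1 ij.2) => cij M.
exact: (cvgZr_tmp (cij M)).
Qed.

Lemma is_derive_linear (R : realType) (U V W : normedModType R)
    (f : {linear V -> W}) (F : U -> V) x v l :
  continuous f -> is_derive x v F l -> is_derive x v (f \o F) (f l).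
Proof.
move=> cf [dF <-].
have fF : (fun h : R =>
    h^-1 *: (((f \o F) \o shift x) (h *: v) - (f \o F) x)) @ 0^' --> f ('D_v F x).
  under eq_cvg do rewrite /= -linearB -linearZ.
  by apply: continuous_cvg; [exact: cf|exact: dF].
by apply: DeriveDef; [exact: cvgP fF|exact/cvg_lim].
Qed.

Lemma mulmxr_differentiable (R : realType) (V : normedModType R) p q r
    (F : V -> 'M[R]_(p, q)) (b : 'M[R]_(q, r)) y :
  differentiable F y -> differentiable (fun z => F z *m b) y.
Proof.
move=> dF; apply: (@differentiable_comp _ _ _ _ F (mulmxr b)) => //.
by apply: linear_differentiable; exact: linear_mx_continuous.
Qed.

Lemma near_eq_differentiable (R : realType) (V W : normedModType R)
    (f g : V -> W) x :
  {near x, f =1 g} -> differentiable f x -> differentiable g x.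
Proof.
move=> fg df; have fgx : f x = g x := nbhs_singleton fg.
have gE : g \o shift x = cst (g x) + 'd f x +o_ 0 id.
  apply/eqaddoP => e e0.
  have /eqaddoP/(_ e e0) := diff_locally df.
  have fg0 : \forall h \near (0 : V), f (h + x) = g (h + x).
    move: fg; rewrite (near_shift 0 x).
    by apply: filterS => h /=; rewrite subr0.
  by apply: filterS2 fg0 => h fgh /=; rewrite !fctE /= -fgh fgx.
have dgf := diff_unique (diff_continuous df) gE.
apply/diff_locallyP; rewrite dgf; split => //; exact: diff_continuous.
Qed.

Lemma cvg_difference_quotient (R : realType) (V W : normedModType R)
    (F : V -> W) x v (t : nat -> R) :
  derivable F x v -> t @ \oo --> 0 -> (forall n, t n != 0) ->
  (t n)^-1 *: (F (x + t n *: v) - F x) @[n --> \oo] --> 'D_v F x.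
Proof.
move=> dF t0 tn0.
have t0' : t @ \oo --> 0^'.
  move=> A /t0 nA.
  suff: \forall n \near \oo, A (t n) by [].
  have : \forall n \near \oo, t n != 0 -> A (t n) by [].
  by apply: filterS => n; apply; exact: tn0.
have -> : (fun n => (t n)^-1 *: (F (x + t n *: v) - F x)) =
    (fun h : R => h^-1 *: ((F \o shift x) (h *: v) - F x)) \o t.
  by apply/funext => n /=; rewrite [x + _]addrC.
exact: cvg_comp t0' dF.
Qed.

Lemma derive_pair2 (R : realType) (U V W : normedModType R) (F : U * V -> W)
    y z v :
  'D_((0, v) : U * V) F (y, z) = 'D_v (fun z' => F (y, z')) z.
Proof.
rewrite /derive; congr (lim (_ @ 0^')); apply/funext => h /=.
rewrite /shift /=.
by have -> : h *: (0 : U, v) + (y, z) = (y, h *: v + z)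
  by congr (_, _); rewrite /= scaler0 add0r.
Qed.

Lemma is_derive_shift (R : realType) (V W : normedModType R) (F : V -> W)
    (p c w : V) l :
  is_derive (p + c) w F l -> is_derive p w (fun q => F (q + c)) l.
Proof.
move=> [dF <-].
have E : (fun h : R => h^-1 *: (((fun q => F (q + c)) \o shift p) (h *: w)
    - F (p + c))) =
    (fun h : R => h^-1 *: ((F \o shift (p + c)) (h *: w) - F (p + c))).
  by apply/funext => h /=; rewrite addrA.
by apply: DeriveDef; rewrite /derivable /derive /= E.
Qed.

Lemma is_derive_line (R : realType) (V W : normedModType R) (F : V -> W)
    (p w : V) (t : R) l :
  is_derive (p + t *: w) w F l ->
  is_derive t 1 (fun s : R => F (p + s *: w)) l.
Proof.
move=> [dF <-].
have E : (fun h : R => h^-1 *: (((fun s : R => F (p + s *: w)) \o shift t) (h *: 1)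
    - F (p + t *: w))) =
    (fun h : R => h^-1 *: ((F \o shift (p + t *: w)) (h *: w) - F (p + t *: w))).
  by apply/funext => h /=; rewrite [h *: 1]mulr1 scalerDl addrCA.
by apply: DeriveDef; rewrite /derivable /derive /= E.
Qed.

Lemma mean_value_line (R : realType) (V : normedModType R) (F G : V -> R)
    (p w : V) (t : R) : 0 <= t ->
  (forall b, 0 <= b <= t -> is_derive (p + b *: w) w F (G (p + b *: w))) ->
  exists2 b, 0 <= b <= t & F (p + t *: w) - F p = t * G (p + b *: w).
Proof.
move=> t0 dF.
have dFl b : b \in `[0, t] ->
    is_derive b 1 (fun s : R => F (p + s *: w)) (G (p + b *: w)).
  by rewrite in_itv /= => bt; exact/is_derive_line/dF.
have cF : {within `[0, t], continuous (fun s : R => F (p + s *: w))}.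
  by apply: derivable_within_continuous => b /dFl [].
have dFo b : b \in `]0, t[ ->
    is_derive b 1 (fun s : R => F (p + s *: w)) (G (p + b *: w)).
  by move=> bt; apply: dFl; exact: subset_itv_oo_cc bt.
have [b bt] := MVT_segment t0 dFo cF.
by rewrite scale0r addr0 subr0 mulrC => ->; exists b.
Qed.

(** Two applications of the mean value theorem: along [w], to the increment
[q |-> F (q + s *: v) - F q], and then along [v], to the derivative [G] of [F]
in the direction [w]. *)
Lemma second_difference (R : realType) (V : normedModType R)
    (F G K : V -> R) (p v w : V) (s t : R) : 0 <= s -> 0 <= t ->
  (forall a b, 0 <= a <= s -> 0 <= b <= t ->
     is_derive (p + a *: v + b *: w) w F (G (p + a *: v + b *: w))) ->
  (forall a b, 0 <= a <= s -> 0 <= b <= t ->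
     is_derive (p + a *: v + b *: w) v G (K (p + a *: v + b *: w))) ->
  exists a b, [/\ 0 <= a <= s, 0 <= b <= t &
    F (p + s *: v + t *: w) - F (p + s *: v) - F (p + t *: w) + F p
    = s * t * K (p + a *: v + b *: w)].
Proof.
move=> s0 t0 dF dG.
have [|b bt] := @mean_value_line R V (fun q => F (q + s *: v) - F q)
    (fun q => G (q + s *: v) - G q) p w t t0.
  move=> b bt; apply: is_deriveB; last first.
    by have := dF 0 b; rewrite scale0r addr0 lexx; apply.
  apply: is_derive_shift; rewrite addrAC.
  by apply: dF => //; rewrite s0 lexx.
have [|a as_] := @mean_value_line R V G K (p + b *: w) v s s0.
  by move=> a as_; rewrite addrAC; exact: dG.
move=> GK FG; exists a, b; split => //.
have -> : p + a *: v + b *: w = p + b *: w + a *: v by rewrite addrAC.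
by rewrite (mulrC s) -mulrA -GK -FG [p + t *: w + _]addrAC; ring.
Qed.

(** * The Euclidean pairing, positive definite matrices and linear systems *)

Definition dotmx (R : realType) m (a v : 'cV[R]_m) : R := (a^T *m v) 0 0.

Lemma dotmx_is_linear (R : realType) m (a : 'cV[R]_m) : linear (dotmx a).
Proof. by move=> c u v; rewrite /dotmx mulmxDr -scalemxAr !mxE. Qed.

HB.instance Definition _ (R : realType) m (a : 'cV[R]_m) :=
  GRing.isLinear.Build R 'cV[R]_m R _ (dotmx a) (dotmx_is_linear a).

Lemma dotmxD (R : realType) m (a u v : 'cV[R]_m) :
  dotmx a (u + v) = dotmx a u + dotmx a v.
Proof. exact: linearD. Qed.

Lemma dotmxN (R : realType) m (a u : 'cV[R]_m) : dotmx a (- u) = - dotmx a u.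
Proof. exact: linearN. Qed.

Lemma dotmxB (R : realType) m (a u v : 'cV[R]_m) :
  dotmx a (u - v) = dotmx a u - dotmx a v.
Proof. exact: linearB. Qed.

Lemma dotmxZ (R : realType) m (a u : 'cV[R]_m) c :
  dotmx a (c *: u) = c * dotmx a u.
Proof. exact: linearZ. Qed.

Lemma dotmx_tr (R : realType) m n (a : 'cV[R]_m) (A : 'M[R]_(m, n)) b :
  dotmx a (A *m b) = dotmx b (A^T *m a).
Proof.
rewrite /dotmx; have -> : b^T *m (A^T *m a) = (a^T *m (A *m b))^T.
  by rewrite !trmx_mul trmxK mulmxA.
by rewrite [RHS]mxE.
Qed.

Lemma dotmx_inj (R : realType) m (u v : 'cV[R]_m) :
  (forall a, dotmx a u = dotmx a v) -> u = v.
Proof.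
move=> uv; apply/colP => i; have := uv (delta_mx i 0).
by rewrite /dotmx trmx_delta -!rowE !mxE.
Qed.

Lemma dotmxC (R : realType) m (a b : 'cV[R]_m) : dotmx a b = dotmx b a.
Proof. by rewrite -{1}[b]mul1mx dotmx_tr trmx1 mul1mx. Qed.

Lemma dotmx_symD (R : realType) m (A : 'M[R]_m) u v : A^T = A ->
  dotmx (u + v) (A *m (u + v)) =
  dotmx u (A *m u) + 2 * dotmx v (A *m u) + dotmx v (A *m v).
Proof.
move=> At; rewrite mulmxDr dotmxD !(dotmxC (u + v)) !dotmxD.
rewrite (dotmxC (A *m v) u) dotmx_tr At (dotmxC (A *m u) v) (dotmxC (A *m u) u).
by rewrite (dotmxC (A *m v) v); ring.
Qed.

Lemma dotmx_col_mx (R : realType) p q (a b : 'cV[R]_p) (c e : 'cV[R]_q) :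
  dotmx (col_mx a c) (col_mx b e) = dotmx a b + dotmx c e.
Proof. by rewrite /dotmx tr_col_mx mul_row_col mxE. Qed.

Lemma dotmx_mxcol (R : realType) n m (a b : 'I_n -> 'cV[R]_m) :
  dotmx (\mxcol_i a i) (\mxcol_i b i) = \sum_i dotmx (a i) (b i).
Proof. by rewrite /dotmx tr_mxcol mul_mxrow_mxcol summxE. Qed.

Lemma posdefmx_unit (R : realType) n (A : 'M[R]_n) : posdefmx A -> A \in unitmx.
Proof.
move=> [At Ap]; rewrite -row_free_unit -kermx_eq0; apply/eqP/row_matrixP => i.
rewrite row0; apply/eqP; apply: contraT => ui.
have /Ap : (row i (kermx A))^T != 0.
  by apply: contra ui => /eqP/(congr1 trmx); rewrite trmxK trmx0 => ->.
by rewrite trmxK -row_mul mulmx_ker row0 mul0mx mxE ltxx.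
Qed.

Lemma posdefmx_inv (R : realType) n (A : 'M[R]_n) : posdefmx A -> posdefmx (invmx A).
Proof.
move=> pA; have uA := posdefmx_unit pA; have [At Ap] := pA.
split=> [|v v0]; first by rewrite trmx_inv At.
have : 0 < ((invmx A *m v)^T *m A *m (invmx A *m v)) 0 0.
  apply: Ap; apply: contra v0 => /eqP h.
  by rewrite -(mulKVmx uA v) h mulmx0.
by rewrite trmx_mul trmx_inv At mulmxA mulmxKV.
Qed.

Lemma posdefmx_dotmx_ge0 (R : realType) m (A : 'M[R]_m) v :
  posdefmx A -> 0 <= dotmx v (A *m v).
Proof.
move=> [_ Ap]; have [->|/Ap] := eqVneq v 0; first by rewrite mulmx0 linear0.
by rewrite /dotmx mulmxA => /ltW.
Qed.

Lemma posdefmx_dotmx_eq0 (R : realType) m (A : 'M[R]_m) v :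
  posdefmx A -> dotmx v (A *m v) = 0 -> v = 0.
Proof.
move=> [_ Ap] Av; apply/eqP; apply: contraPT Av => /Ap.
by rewrite /dotmx mulmxA => /lt0r_neq0/eqP.
Qed.

(** A square system is solvable when its right hand side is orthogonal to the
kernel of the transposed matrix; for a vector [c] of this kernel the quadratic
form of [A] vanishes, so that the hypothesis applies. *)
Lemma solvable_of_kernel (R : realType) n (A : 'M[R]_n) (Y : 'cV[R]_n) :
  (forall c : 'cV[R]_n, dotmx c (A *m c) = 0 -> dotmx c Y = 0) ->
  exists c, A *m c = Y.
Proof.
move=> AY; suff /submxP[D YE] : (Y^T <= A^T)%MS.
  by exists D^T; apply: trmx_inj; rewrite trmx_mul trmxK.
rewrite submxE; apply/eqP/rowP => j; rewrite [RHS]mxE.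
have cE : A^T *m col j (cokermx A^T) = 0.
  by rewrite colE mulmxA mulmx_coker mul0mx.
have := AY (col j (cokermx A^T)); rewrite dotmx_tr cE (dotmxC _ Y).
have -> : dotmx (col j (cokermx A^T)) 0 = 0 by rewrite /dotmx mulmx0 mxE.
by move=> /(_ erefl); rewrite /dotmx colE mulmxA -colE mxE.
Qed.

Lemma sum_ord_max (V : nmodType) n (F : 'I_n.+1 -> V) :
  \sum_i F i = \sum_i F (lift ord_max i) + F ord_max.
Proof. by rewrite (bigD1_ord ord_max) //= addrC. Qed.

Lemma add_last_lift (T : Type) n (f : 'I_n -> T) a i :
  add_last f a (lift ord_max i) = f i.
Proof. by rewrite /add_last liftK. Qed.

Lemma add_last_max (T : Type) n (f : 'I_n -> T) a : add_last f a ord_max = a.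
Proof. by rewrite /add_last unlift_none. Qed.

(** * Inner products and weak limits in a Hilbert space *)

Section HilbertSpace.
Variables (R : realType) (E : lmodType R) (H : set E) (ip : E -> E -> R).
Hypothesis HH : hilbert_space H ip.

Lemma hilbertD f g : H f -> H g -> H (f + g).
Proof. by move=> Hf Hg; rewrite -[f]scale1r; apply: hilbertP HH _ _ _ Hf Hg. Qed.

Lemma hilbertZ a f : H f -> H (a *: f).
Proof.
by move=> Hf; rewrite -[_ *: _]addr0; apply: hilbertP HH _ _ _ Hf (hilbert0 HH).
Qed.

Lemma hilbertB f g : H f -> H g -> H (f - g).
Proof. by move=> Hf Hg; rewrite -scaleN1r; exact: hilbertD (hilbertZ _ _). Qed.

Lemma hilbert_sum n (F : 'I_n -> E) : (forall i, H (F i)) -> H (\sum_i F i).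
Proof.
by move=> HF; apply: big_ind => //; [exact: hilbert0 HH|exact: hilbertD].
Qed.

Lemma ipDl f g h : H f -> H g -> H h -> ip (f + g) h = ip f h + ip g h.
Proof.
by move=> Hf Hg Hh; rewrite -[f in LHS]scale1r (hilbert_ipP HH) ?mul1r.
Qed.

Lemma ip0l h : H h -> ip 0 h = 0.
Proof.
move=> Hh; have := ipDl (hilbert0 HH) (hilbert0 HH) Hh; rewrite addr0.
by move/eqP; rewrite -subr_eq0 opprD addrA subrr sub0r oppr_eq0 => /eqP.
Qed.

Lemma ipZl a f h : H f -> H h -> ip (a *: f) h = a * ip f h.
Proof.
move=> Hf Hh; rewrite -[a *: f]addr0 (hilbert_ipP HH) ?ip0l ?addr0 //.
exact: hilbert0 HH.
Qed.

Lemma ipBl f g h : H f -> H g -> H h -> ip (f - g) h = ip f h - ip g h.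
Proof.
move=> Hf Hg Hh; rewrite -scaleN1r ipDl ?ipZl ?mulN1r //; exact: hilbertZ.
Qed.

Lemma ip_suml n (F : 'I_n -> E) h : (forall i, H (F i)) -> H h ->
  ip (\sum_i F i) h = \sum_i ip (F i) h.
Proof.
move=> HF Hh; elim: n F HF => [|n IH] F HF; first by rewrite !big_ord0 ip0l.
by rewrite !big_ord_recl ipDl ?IH //; exact: hilbert_sum.
Qed.

Lemma ipDr f g h : H f -> H g -> H h -> ip h (f + g) = ip h f + ip h g.
Proof.
move=> Hf Hg Hh; rewrite !(hilbert_ipC HH Hh) ?ipDl //; exact: hilbertD.
Qed.

Lemma ipZr a f h : H f -> H h -> ip h (a *: f) = a * ip h f.
Proof.
by move=> Hf Hh; rewrite !(hilbert_ipC HH Hh) ?ipZl //; exact: hilbertZ.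
Qed.

Lemma ipBr f g h : H f -> H g -> H h -> ip h (f - g) = ip h f - ip h g.
Proof.
move=> Hf Hg Hh; rewrite !(hilbert_ipC HH Hh) ?ipBl //; exact: hilbertB.
Qed.

Lemma ip_sumr n (F : 'I_n -> E) h : (forall i, H (F i)) -> H h ->
  ip h (\sum_i F i) = \sum_i ip h (F i).
Proof.
move=> HF Hh; rewrite (hilbert_ipC HH Hh (hilbert_sum HF)) ip_suml //.
by apply: eq_bigr => i _; rewrite (hilbert_ipC HH).
Qed.

Lemma hnorm_sqr f : H f -> hnorm ip f ^+ 2 = ip f f.
Proof. by move=> Hf; rewrite sqr_sqrtr // (hilbert_ip_ge0 HH). Qed.

Lemma cauchy_schwarz f g : H f -> H g -> `|ip f g| <= hnorm ip f * hnorm ip g.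
Proof.
move=> Hf Hg.
suff h : ip f g ^+ 2 <= ip f f * ip g g.
  rewrite -sqrtrM ?(hilbert_ip_ge0 HH) // -sqrtr_sqr ler_sqrt //.
  by rewrite mulr_ge0 // (hilbert_ip_ge0 HH).
have [g0|gn0] := eqVneq (ip g g) 0.
  by rewrite (hilbert_ip_eq0 HH Hg g0) (hilbert_ipC HH Hf) ?ip0l ?mulr0 ?expr0n //;
     exact: hilbert0 HH.
have gp : 0 < ip g g by rewrite lt0r gn0 (hilbert_ip_ge0 HH).
(* Up to the factor ip g g, the difference p - q is the component of f
   orthogonal to g. *)
have Hp := hilbertZ (ip g g) Hf; have Hq := hilbertZ (ip f g) Hg.
have := hilbert_ip_ge0 HH (hilbertB Hp Hq).
rewrite ipBl ?ipBr ?ipZl ?ipZr ?(hilbert_ipC HH Hg Hf) //; try exact: hilbertB.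
move=> h; rewrite -subr_ge0 -(pmulr_rge0 _ gp).
by move: h; congr (_ <= _); ring.
Qed.

(** The condition says that the Gram matrix of the sequence converges at
infinity.  Expanding [|u_p - u_q|^2] then shows that the sequence is Cauchy, and
convergence in norm implies weak convergence by [cauchy_schwarz]. *)
Lemma gram_limit (u : nat -> E) (c : R) : (forall n, H (u n)) ->
  (forall e : R, 0 < e -> \forall p & q \near \oo, `|ip (u p) (u q) - c| < e) ->
  exists2 g, H g & forall f, H f -> ip f (u n) @[n --> \oo] --> ip f g.
Proof.
move=> Hu uc.
have [e e0|g Hg ug] := hilbert_complete HH Hu.
  have e4 : 0 < e ^+ 2 / 4 by rewrite divr_gt0 // exprn_gt0.
  have [[A B] /= [[a _ aA] [b _ bB]] AB] := uc _ e4.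
  exists ([set n | (maxn a b <= n)%N], [set n | (maxn a b <= n)%N]).
    by split; exists (maxn a b).
  move=> [p q] /= []; rewrite !geq_max => /andP[ap bp] /andP[aq bq].
  have pp := AB (p, p) (conj (aA _ ap) (bB _ bp)).
  have pq := AB (p, q) (conj (aA _ ap) (bB _ bq)).
  have qq := AB (q, q) (conj (aA _ aq) (bB _ bq)).
  move: pp pq qq; rewrite /= !ltr_distl.
  move=> /andP[_ pp] /andP[pq _] /andP[_ qq].
  rewrite -(gtr0_norm e0) -(sqrtr_sqr e) ltr_sqrt ?exprn_gt0 //.
  rewrite ipBl ?ipBr ?(hilbert_ipC HH (Hu q) (Hu p)) //; try exact: hilbertB.
  by lra.
exists g => // f Hf; apply/cvgrPdist_lt => e e0.
have f1 : 0 < hnorm ip f + 1 by rewrite ltr_pwDr // sqrtr_ge0.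
near=> n.
have -> : ip f g - ip f (u n) = - ip f (u n - g) by rewrite ipBr ?opprB.
rewrite normrN; apply: le_lt_trans (cauchy_schwarz Hf (hilbertB (Hu n) Hg)) _.
have ung : hnorm ip (u n - g) < e / (hnorm ip f + 1).
  near: n; move/cvgrPdist_lt : ug => /(_ _ (divr_gt0 e0 f1)).
  by apply: filterS => n; rewrite sub0r normrN ger0_norm // sqrtr_ge0.
apply: (@le_lt_trans _ _ ((hnorm ip f + 1) * hnorm ip (u n - g))).
  by rewrite ler_wpM2r ?sqrtr_ge0 // lerDl.
by rewrite mulrC -ltr_pdivlMr.
Unshelve. all: by end_near. Qed.

End HilbertSpace.

(** * Regularity of the kernel and of its sections *)

Section KernelRegularity.
Variables (R : realType) (d m : nat) (Omega : set 'cV[R]_d).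
Variables (k : 'cV[R]_d -> 'cV[R]_d -> 'M[R]_m).
Hypothesis Omega_open : open Omega.
Hypothesis k_C2 : class_C 2 (Omega `*` Omega)
  (fun p : 'cV[R]_d * 'cV[R]_d => k p.1 p.2).

Let K (p : 'cV[R]_d * 'cV[R]_d) := k p.1 p.2.

(** The representer of the functional [f |-> b^T (D_v f)(x)], extended by [0]
outside of [Omega] like the functions of the native space. *)
Definition dsection (v x : 'cV[R]_d) (b : 'cV[R]_m) : 'cV[R]_d -> 'cV[R]_m :=
  patch (fun=> 0) Omega (fun z => 'D_v (k z) x *m b).

Lemma ksectionE x a z : Omega z -> ksection Omega k x a z = k z x *m a.
Proof. by move=> Oz; rewrite /ksection patchT // inE. Qed.

Lemma dsectionE v x b z : Omega z -> dsection v x b z = 'D_v (k z) x *m b.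
Proof. by move=> Oz; rewrite /dsection patchT // inE. Qed.

Lemma kernel_differentiable y z : Omega y -> Omega z -> differentiable K (y, z).
Proof. by move=> Oy Oz; apply: (proj1 k_C2). Qed.

Lemma kernel_derive_differentiable w y z : Omega y -> Omega z ->
  differentiable ('D_w K) (y, z).
Proof. by move=> Oy Oz; apply: (proj1 (proj2 k_C2 w)). Qed.

Lemma kernel_derive2_continuous w w' y z : Omega y -> Omega z ->
  {for (y, z), continuous ('D_w' ('D_w K))}.
Proof. by move=> Oy Oz; apply: (proj2 (proj2 k_C2 w) w'). Qed.

Lemma patch_near (f : 'cV[R]_d -> 'cV[R]_m) y :
  Omega y -> \forall z \near y, f z = patch (fun=> 0) Omega f z.
Proof.
move=> Oy; apply: filterS (open_nbhs_nbhs (conj Omega_open Oy)) => z Oz.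
by rewrite patchT // inE.
Qed.

Lemma ksection_differentiable x a y : Omega x -> Omega y ->
  differentiable (ksection Omega k x a) y.
Proof.
move=> Ox Oy; apply: near_eq_differentiable (patch_near _ Oy) _.
apply: mulmxr_differentiable.
apply: (@differentiable_comp _ _ _ _ (fun z => (z, x)) K).
  exact: differentiable_pair.
exact: kernel_differentiable.
Qed.

Lemma kernel_derive_differentiable1 v x y : Omega x -> Omega y ->
  differentiable (fun z => 'D_v (k z) x) y.
Proof.
move=> Ox Oy.
have -> : (fun z => 'D_v (k z) x) = 'D_(0, v) K \o (fun z => (z, x)).
  by apply/funext => z /=; rewrite derive_pair2.
apply: differentiable_comp; first exact: differentiable_pair.
exact: kernel_derive_differentiable.
Qed.

Lemma dsection_differentiable v x b y : Omega x -> Omega y ->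
  differentiable (dsection v x b) y.
Proof.
move=> Ox Oy; apply: near_eq_differentiable (patch_near _ Oy) _.
exact/mulmxr_differentiable/kernel_derive_differentiable1.
Qed.

Lemma derive_dsection v w x b y : Omega x -> Omega y ->
  'D_w (dsection v x b) y = 'D_w (fun z => 'D_v (k z) x) y *m b.
Proof.
move=> Ox Oy; rewrite -(near_eq_derive w (patch_near _ Oy)).
have := kernel_derive_differentiable1 v Ox Oy.
move=> /(diff_derivable (v := w))/derivableP dD.
have cb : continuous (mulmxr b : 'M[R]_m -> 'cV[R]_m).
  exact: linear_mx_continuous.
by have [_ ->] := is_derive_linear cb dD.
Qed.

Lemma segment_in_open x v : Omega x ->
  exists2 r : R, 0 < r & forall t, 0 <= t <= r -> Omega (x + t *: v).
Proof.
move=> Ox.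
have cl : {for (0 : R), continuous (fun t : R => x + t *: v)}.
  apply: cvgD; first exact: cvg_cst.
  exact: scalel_continuous.
have /cl : nbhs (x + (0 : R) *: v) Omega.
  by rewrite scale0r addr0; exact: open_nbhs_nbhs.
move=> /nbhs_ballP[e /= e0 eO]; exists (e / 2); first by rewrite divr_gt0.
move=> t /andP[t0 te]; apply: eO; rewrite -ball_normE /= sub0r normrN ger0_norm //.
by apply: le_lt_trans te _; rewrite ltr_pdivrMr // ltr_pMr // ltr1n.
Qed.

Definition quadform (b : 'cV[R]_m) : {linear 'M[R]_m -> R} :=
  [the {linear _ -> _} of dotmx b \o mulmxr b].

(** By the reproducing property, the left hand side is the inner product of
[k(., x + s v) b - k(., x) b] and [k(., x + t v) b - k(., x) b]. *)
Lemma kernel_second_difference x v b (s t : R) : 0 <= s -> 0 <= t ->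
  (forall a, 0 <= a <= s -> Omega (x + a *: v)) ->
  (forall a, 0 <= a <= t -> Omega (x + a *: v)) ->
  exists a a', [/\ 0 <= a <= s, 0 <= a' <= t &
    dotmx b (k (x + s *: v) (x + t *: v) *m b) - dotmx b (k (x + s *: v) x *m b)
    - dotmx b (k x (x + t *: v) *m b) + dotmx b (k x x *m b)
    = s * t * quadform b ('D_(v, 0) ('D_(0, v) K) (x + a *: v, x + a' *: v))].
Proof.
move=> s0 t0 Os Ot.
have E a a' : (x, x) + a *: (v, 0 : 'cV[R]_d) + a' *: (0 : 'cV[R]_d, v) =
    (x + a *: v, x + a' *: v).
  by congr (_, _); rewrite /= !scaler0 !addr0.
have E1 a : (x, x) + a *: (v, 0 : 'cV[R]_d) = (x + a *: v, x).
  by congr (_, _); rewrite /= !scaler0 !addr0.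
have E2 a : (x, x) + a *: (0 : 'cV[R]_d, v) = (x, x + a *: v).
  by congr (_, _); rewrite /= !scaler0 !addr0.
have cq : continuous (quadform b) by exact: linear_mx_continuous.
have [||a [a' [as_ at_]]] := @second_difference R _ (quadform b \o K)
  (quadform b \o 'D_(0, v) K) (quadform b \o 'D_(v, 0) ('D_(0, v) K))
  (x, x) (v, 0) (0, v) s t s0 t0.
- move=> a a' as_ at_; rewrite E; apply: is_derive_linear => //.
  apply/derivableP/diff_derivable/kernel_differentiable; [exact: Os|exact: Ot].
- move=> a a' as_ at_; rewrite E; apply: is_derive_linear => //.
  by apply/derivableP/diff_derivable/kernel_derive_differentiable;
    [exact: Os|exact: Ot].
by rewrite !E E1 E2 => D; exists a, a'.
Qed.

End KernelRegularity.

(** * Derivatives as inner products *)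

Section NativeSpace.
Variables (R : realType) (d m : nat) (Omega : set 'cV[R]_d).
Variables (k : 'cV[R]_d -> 'cV[R]_d -> 'M[R]_m).
Variables (H : set ('cV[R]_d -> 'cV[R]_m)).
Variables (ip : ('cV[R]_d -> 'cV[R]_m) -> ('cV[R]_d -> 'cV[R]_m) -> R).
Hypothesis Omega_open : open Omega.
Hypothesis k_C2 : class_C 2 (Omega `*` Omega)
  (fun p : 'cV[R]_d * 'cV[R]_d => k p.1 p.2).
Hypothesis H_native : native_space Omega k H ip.

Let HH := native_hilbert H_native.
Let K (p : 'cV[R]_d * 'cV[R]_d) := k p.1 p.2.

Lemma reproducing f x a : H f -> Omega x ->
  ip f (ksection Omega k x a) = dotmx a (f x).
Proof. exact: (native_reproducing H_native). Qed.

Lemma reproducing_sym x a f : H f -> Omega x ->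
  ip (ksection Omega k x a) f = dotmx a (f x).
Proof.
move=> Hf Ox; rewrite -reproducing //; apply: (hilbert_ipC HH) => //.
exact: (native_section H_native).
Qed.

(** The representer is the limit, in the native space, of the difference
quotients of the sections [k(., x + t v) b] as [t] tends to [0]: taking the inner
product of these quotients with [f] gives the difference quotients of [b^T f]. *)
Lemma derivative_representer v x b : Omega x -> H (dsection Omega k v x b) /\
  forall f, H f -> derivable f x v ->
    ip f (dsection Omega k v x b) = dotmx b ('D_v f x).
Proof.
move=> Ox; have [r r0 rO] := segment_in_open Omega_open v Ox.
(* The bound by r keeps x + t_n v in Omega, so that the sections centered at
   these points belong to the native space. *)
pose t n : R := r * harmonic n.
have t_gt0 n : 0 < t n by rewrite mulr_gt0 // harmonic_gt0.
have tr n : t n <= r.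
  by rewrite /t /= ler_piMr ?(ltW r0) // invf_le1 // ler1n.
have tO n a : 0 <= a <= t n -> Omega (x + a *: v).
  by move=> /andP[a0 an]; apply: rO; rewrite a0 (le_trans an).
have tOn n : Omega (x + t n *: v) by apply: (tO n); rewrite lexx ltW.
have t_cvg0 : t @ \oo --> 0.
  by rewrite -[X in _ --> X](mulr0 r); apply: cvgMr; exact: cvg_harmonic.
have tn0 n : t n != 0 by rewrite gt_eqF.
pose ks y := ksection Omega k y b.
have Hks y : Omega y -> H (ks y) by exact: (native_section H_native).
pose u n := (t n)^-1 *: (ks (x + t n *: v) - ks x).
have Hu n : H (u n).
  by apply: (hilbertZ HH); apply: (hilbertB HH); apply: Hks.
have ip_u f n : H f -> ip f (u n) = dotmx b ((t n)^-1 *: (f (x + t n *: v) - f x)).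
  move=> Hf; have H1 := Hks _ (tOn n); have H2 := Hks _ Ox.
  rewrite /u (ipZr HH) //; last exact: (hilbertB HH).
  by rewrite (ipBr HH) // !reproducing // linearZ linearB.
have lim_u f : H f -> derivable f x v -> ip f (u n) @[n --> \oo] --> dotmx b ('D_v f x).
  move=> Hf df; under eq_cvg do rewrite ip_u //.
  apply: continuous_cvg; first exact: linear_mx_continuous.
  exact: cvg_difference_quotient.
(* The inner product of two difference quotients is a difference quotient of
   second order of the kernel in its two arguments. *)
have gram_u p q : exists a a', [/\ 0 <= a <= t q, 0 <= a' <= t p &
    ip (u p) (u q) =
    quadform b ('D_(v, 0) ('D_(0, v) K) (x + a *: v, x + a' *: v))].
  have [||a [a' [aq a'p D]]] := @kernel_second_difference R d m Omega k
    k_C2 x v b (t q) (t p) (ltW (t_gt0 q)) (ltW (t_gt0 p)); [exact: tO|exact: tO|].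
  exists a, a'; split=> //; apply: (mulfI (mulf_neq0 (tn0 q) (tn0 p))).
  rewrite -D ip_u // /u /= !fctE /ks !ksectionE // !(dotmxZ, dotmxB).
  by field; rewrite !tn0.
have [e e0|g Hg ug] := gram_limit
    (c := quadform b ('D_(v, 0) ('D_(0, v) K) (x, x))) HH Hu.
  have c1 : (x + s.1 *: v, x + s.2 *: v) @[s --> ((0, 0) : R * R)] --> (x, x).
    have cx (f : R * R -> R) : f s @[s --> (0, 0)] --> (0 : R) ->
        x + f s *: v @[s --> (0, 0)] --> x.
      move=> f0; rewrite -[X in _ --> X]addr0 -(scale0r v).
      by apply: cvgD; [exact: cvg_cst|exact: cvgZr_tmp].
    exact: (cvg_pair (cx _ cvg_fst) (cx _ cvg_snd)).
  have c2 := cvg_comp _ _ c1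
    (kernel_derive2_continuous k_C2 (w := (0, v)) (w' := (v, 0)) Ox Ox).
  have cq : continuous (quadform b) by exact: linear_mx_continuous.
  have c3 := cvg_comp _ _ c2 (cq ('D_(v, 0) ('D_(0, v) K) (x, x))).
  move/cvgrPdist_lt : c3 => /(_ e e0).
  move=> /nbhs_ballP[del /= del0 close].
  have tdel : \forall n \near \oo, t n < del.
    move/cvgrPdist_lt : t_cvg0 => /(_ del del0); apply: filterS => n.
    by rewrite sub0r normrN gtr0_norm.
  exists ([set n | t n < del], [set n | t n < del]) => // -[p q] /= [pd qd].
  have [a [a' [/andP[a0 aq] /andP[a'0 a'p] ->]]] := gram_u p q.
  rewrite distrC; apply: (close (a, a')); split;
    rewrite /= -ball_normE /= sub0r normrN ger0_norm //.
    exact: le_lt_trans qd.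
  exact: le_lt_trans pd.
(* The inner product with the section of the kernel at z evaluates at z. *)
have gE : g = dsection Omega k v x b.
  apply/funext => z; have [Oz|nOz] := pselect (Omega z); last first.
    by rewrite (native_dom H_native Hg nOz) /dsection /patch memNset.
  rewrite dsectionE //; apply: dotmx_inj => a.
  have Hz := native_section H_native a Oz.
  rewrite -(reproducing_sym a Hg Oz).
  have un : (fun n => ip (ksection Omega k z a) (u n)) = (fun n =>
      dotmx a ((t n)^-1 *: (k z (x + t n *: v) - k z x) *m b)).
    apply/funext => n.
    by rewrite reproducing_sym // /u /= !fctE /ks !ksectionE // -mulmxBl -scalemxAl.
  have dkz : derivable (k z) x v.
    apply/diff_derivable/(@differentiable_comp _ _ _ _ (fun y => (z, y)) K).
      exact: differentiable_pair.
    exact: (kernel_differentiable k_C2).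
  have cq : continuous [the {linear 'M[R]_m -> R} of dotmx a \o mulmxr b].
    exact: linear_mx_continuous.
  have lim_uz := cvg_comp _ _ (cvg_difference_quotient dkz t_cvg0 tn0)
    (cq ('D_v (k z) x)).
  have := ug _ Hz; rewrite un => ug_z.
  exact: (cvg_unique _ ug_z lim_uz).
rewrite -gE; split => // f Hf df.
exact: (cvg_unique _ (ug f Hf) (lim_u f Hf df)).
Qed.

End NativeSpace.

(** * The linear system and the minimizer *)

Section Solution.
Variables (R : realType) (d m N : nat) (Omega : set 'cV[R]_d).
Variables (k : 'cV[R]_d -> 'cV[R]_d -> 'M[R]_m).
Variables (H : set ('cV[R]_d -> 'cV[R]_m)).
Variables (ip : ('cV[R]_d -> 'cV[R]_m) -> ('cV[R]_d -> 'cV[R]_m) -> R).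
Variables (x : 'I_N -> 'cV[R]_d) (y : 'I_N -> 'cV[R]_m) (w : 'I_N -> 'M[R]_m).
Hypothesis Omega_open : open Omega.
Hypothesis Omega0 : Omega 0.
Hypothesis k_C2 : class_C 2 (Omega `*` Omega)
  (fun p : 'cV[R]_d * 'cV[R]_d => k p.1 p.2).
Hypothesis H_native : native_space Omega k H ip.
Hypothesis x_Omega : forall i, Omega (x i).
Hypothesis w_posdef : forall i, posdefmx (w i).

Let HH := native_hilbert H_native.
Local Notation e_ := (@stdvec R d).
Local Notation winv := (add_last (fun j => invmx (w j)) (0 : 'M[R]_m)).
Local Notation system_mx :=
  (block_mx (mxA k x + mxW w) (mxB k x) (mxB k x)^T (mxC k)).

(** The ansatz as an element of the native space, hence extended by [0] outside
of [Omega]. *)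
Definition spanfun (a : 'I_N.+1 -> 'cV[R]_m) (b : 'I_d -> 'cV[R]_m) :
    'cV[R]_d -> 'cV[R]_m :=
  \sum_(i < N.+1) ksection Omega k (centers x i) (a i)
  + \sum_(j < d) dsection Omega k (e_ j) 0 (b j).

Lemma centers_Omega i : Omega (centers x i).
Proof. by rewrite /centers /add_last; case: (unlift _ i) => [j|] /=. Qed.

Lemma ksection_H i a : H (ksection Omega k (centers x i) a).
Proof. exact/(native_section H_native)/centers_Omega. Qed.

Lemma dsection_H j b : H (dsection Omega k (e_ j) 0 b).
Proof. exact: (derivative_representer Omega_open k_C2 H_native _ _ Omega0).1. Qed.

Lemma spanfun_H a b : H (spanfun a b).
Proof.
apply: (hilbertD HH); apply: (hilbert_sum HH) => i; first exact: ksection_H.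
exact: dsection_H.
Qed.

Lemma spanfun_ansatz a b z : Omega z -> spanfun a b z = ansatz k x a b z.
Proof.
move=> Oz; rewrite /spanfun /ansatz fctE !fct_sumE; congr (_ + _).
  by apply: eq_bigr => i _; rewrite ksectionE.
by apply: eq_bigr => j _; rewrite dsectionE.
Qed.

Lemma spanfun_differentiable a b : differentiable (spanfun a b) 0.
Proof.
apply: differentiableD; apply: differentiable_sum => i.
  by apply: ksection_differentiable => //; exact: centers_Omega.
exact: dsection_differentiable.
Qed.

Lemma ip_spanfun f a b : H f -> differentiable f 0 ->
  ip f (spanfun a b) = \sum_(i < N.+1) dotmx (a i) (f (centers x i))
    + \sum_(j < d) dotmx (b j) ('D_(e_ j) f 0).
Proof.
move=> Hf df; have Ha i := ksection_H i (a i); have Hb j := dsection_H j (b j).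
rewrite (ipDr HH) //; try exact: (hilbert_sum HH).
rewrite !(ip_sumr HH) //; congr (_ + _); apply: eq_bigr => i _.
  by rewrite (reproducing H_native) //; exact: centers_Omega.
apply: (derivative_representer Omega_open k_C2 H_native _ _ Omega0).2 => //.
exact: diff_derivable.
Qed.

(** The inner product of a section with a derivative representer can be read
either as a derivative of the section or as a value of the representer; this is
where the transposed block [B^T] comes from. *)
Lemma derive_ksection i j a :
  'D_(e_ i) (ksection Omega k (centers x j) a) 0
  = (partial2 k i (centers x j) 0)^T *m a.
Proof.
have Oc := centers_Omega j; have Hk := ksection_H j a.
apply: dotmx_inj => c; rewrite -dotmx_tr.
have [Hd <-] := derivative_representer Omega_open k_C2 H_native (e_ i) c Omega0;
  rewrite ?(reproducing_sym H_native) ?dsectionE //.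
by apply/diff_derivable/ksection_differentiable.
Qed.

Lemma derive_spanfun i a b :
  'D_(e_ i) (spanfun a b) 0 =
  \sum_(j < N.+1) (partial2 k i (centers x j) 0)^T *m a j
  + \sum_(j < d) partial1 (fun u v => partial2 k j u v) i 0 0 *m b j.
Proof.
have da j : derivable (ksection Omega k (centers x j) (a j)) 0 (e_ i).
  by apply/diff_derivable/ksection_differentiable => //; exact: centers_Omega.
have db j : derivable (dsection Omega k (e_ j) 0 (b j)) 0 (e_ i).
  exact/diff_derivable/dsection_differentiable.
rewrite deriveD ?derive_sum //; try exact: derivable_sum.
congr (_ + _); apply: eq_bigr => j _; first exact: derive_ksection.
exact: derive_dsection.
Qed.

(** The rows of [A] and [B] evaluate the ansatz at the centers, and those of
[B^T] and [C] evaluate its partial derivatives at [0]; only [W] is added to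
this. *)
Lemma system_mul a b :
  system_mx *m col_mx (\mxcol_(i < N.+1) a i) (\mxcol_(i < d) b i)
  = col_mx (\mxcol_(i < N.+1) (spanfun a b (centers x i) + winv i *m a i))
      (\mxcol_(j < d) 'D_(e_ j) (spanfun a b) 0).
Proof.
rewrite mul_block_col mulmxDl /mxA /mxW /mxB /mxC tr_mxblock.
rewrite mul_mxdiag_mxcol !mul_mxblock_mxrow -!mxcolD.
congr col_mx; apply: eq_mxcol => i; last by rewrite derive_spanfun.
by rewrite (spanfun_ansatz _ _ (centers_Omega i)) /ansatz addrAC.
Qed.

Lemma solves_systemP a b : solves_system k x y w a b <->
  [/\ forall i, spanfun a b (x i) + invmx (w i) *m a (lift ord_max i) = y i,
      spanfun a b 0 = 0 & forall j, 'D_(e_ j) (spanfun a b) 0 = 0].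
Proof.
rewrite /solves_system system_mul /vecY -(mxcol0 (p_ := fun=> m)).
split=> [/eq_col_mx[/eq_mxcolP hc /eq_mxcolP hd]|[hx h0 hd]].
  split=> [i||//].
    by have := hc (lift ord_max i); rewrite /centers !add_last_lift.
  by have := hc ord_max; rewrite /centers !add_last_max mul0mx addr0.
congr col_mx; apply: eq_mxcol => i //.
rewrite /centers; case: (unliftP ord_max i) => [j|] ->.
  by rewrite !add_last_lift.
by rewrite !add_last_max mul0mx addr0.
Qed.

Lemma system_form a b :
  let c := col_mx (\mxcol_(i < N.+1) a i) (\mxcol_(i < d) b i) in
  dotmx c (system_mx *m c)
  = ip (spanfun a b) (spanfun a b)
    + \sum_(i < N) dotmx (a (lift ord_max i)) (invmx (w i) *m a (lift ord_max i)).
Proof.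
move=> c; rewrite system_mul dotmx_col_mx !dotmx_mxcol.
rewrite (ip_spanfun a b (spanfun_H a b) (spanfun_differentiable a b)).
under eq_bigr do rewrite dotmxD.
rewrite big_split /= addrAC [X in _ + X = _]sum_ord_max add_last_max.
rewrite mul0mx linear0 addr0; congr (_ + _).
by apply: eq_bigr => i _; rewrite add_last_lift.
Qed.

(** All terms of [system_form] are nonnegative.  If their sum vanishes, then so
does each [alpha_i^T w_i^-1 alpha_i], whence [alpha_i = 0] for the blocks that
pair with the data; the remaining blocks of the right hand side are [0]. *)
Lemma system_solvable : exists a b, solves_system k x y w a b.
Proof.
have [c Ec|c Mc] := @solvable_of_kernel R _ system_mx
  (col_mx (vecY y) 0); last first.
  exists (submxcol (usubmx c)), (submxcol (dsubmx c)).
  by rewrite /solves_system !submxcolK vsubmxK.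
pose a := submxcol (usubmx c); pose b := submxcol (dsubmx c).
have cE : c = col_mx (\mxcol_i a i) (\mxcol_i b i) by rewrite !submxcolK vsubmxK.
have winv_ge0 i : 0 <= dotmx (a (lift ord_max i)) (invmx (w i) *m a (lift ord_max i)).
  exact/posdefmx_dotmx_ge0/posdefmx_inv.
move: Ec; rewrite cE system_form => /eqP; rewrite paddr_eq0; last 2 first.
- exact/(hilbert_ip_ge0 HH)/spanfun_H.
- exact: sumr_ge0.
move=> /andP[_]; rewrite psumr_eq0 // => /allP a0.
rewrite dotmx_col_mx linear0 addr0 /vecY dotmx_mxcol sum_ord_max add_last_max.
rewrite linear0 addr0 big1 // => i _.
have /eqP/posdefmx_dotmx_eq0 -> := a0 i (mem_index_enum i).
  by rewrite dotmxC linear0.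
exact: posdefmx_inv.
Qed.

Lemma solution_feasible a b : solves_system k x y w a b ->
  feasible H (spanfun a b).
Proof.
move=> /solves_systemP[_ h0 hd].
split; [exact: spanfun_H|exact: h0|exact: spanfun_differentiable|].
by apply/matrixP => i j; rewrite !mxE hd mxE.
Qed.

(** The cost is a quadratic function without linear term around a solution, as
[w_i (h(x_i) - y_i) = - alpha_i] makes the linear part of the data term the
opposite of that of the norm. *)
Lemma cost_feasible a b t : solves_system k x y w a b -> feasible H t ->
  cost ip x y w t = cost ip x y w (spanfun a b)
    + ip (t - spanfun a b) (t - spanfun a b)
    + \sum_(i < N) dotmx (t (x i) - spanfun a b (x i))
        (w i *m (t (x i) - spanfun a b (x i))).
Proof.
move=> Sab [Ht t0 dt Jt]; have [hx h0 hd] := (solves_systemP a b).1 Sab.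
set h := spanfun a b in hx h0 hd *; have Hh : H h := spanfun_H a b.
have dh : differentiable h 0 := spanfun_differentiable a b.
pose u := t - h; have Hu : H u by exact: (hilbertB HH).
have tE : t = h + u by rewrite /u addrC subrK.
have du : differentiable u 0 by exact: differentiableB.
have ip_uh : ip u h = \sum_(i < N) dotmx (a (lift ord_max i)) (u (x i)).
  rewrite (ip_spanfun a b Hu du).
  rewrite [X in _ + X]big1 ?addr0 => [|j _]; last first.
    rewrite deriveB ?hd ?subr0; try exact: diff_derivable.
    have -> : 'D_(e_ j) t 0 = 0.
      by apply/colP => i; move/matrixP: Jt => /(_ i j); rewrite !mxE.
    by rewrite linear0.
  rewrite sum_ord_max /centers add_last_max /u !fctE t0 h0 subr0 linear0 addr0.
  by apply: eq_bigr => i _; rewrite add_last_lift.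
have ip_tt : ip t t = ip h h + 2 * ip u h + ip u u.
  rewrite tE (ipDl HH Hh Hu (hilbertD HH Hh Hu)).
  rewrite (ipDr HH Hh Hu Hh) (ipDr HH Hh Hu Hu) (hilbert_ipC HH Hh Hu).
  by ring.
have fit i : ((t (x i) - y i)^T *m w i *m (t (x i) - y i)) 0 0
    = ((h (x i) - y i)^T *m w i *m (h (x i) - y i)) 0 0
      - 2 * dotmx (a (lift ord_max i)) (u (x i)) + dotmx (u (x i)) (w i *m u (x i)).
  have -> : t (x i) - y i = (h (x i) - y i) + u (x i).
    by rewrite /u !fctE [RHS]addrC subrKA.
  rewrite -!mulmxA -!/(dotmx _ _) dotmx_symD; last by have [] := w_posdef i.
  have -> : w i *m (h (x i) - y i) = - a (lift ord_max i).
    rewrite -(hx i) opprD addrA subrr sub0r mulmxN mulKVmx //.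
    exact: posdefmx_unit.
  by rewrite !dotmxN (dotmxC (u _) (a _)); ring.
rewrite /cost !(hnorm_sqr HH) // ip_tt; under eq_bigr do rewrite fit.
rewrite !big_split /= sumrN -mulr_sumr ip_uh.
by ring.
Qed.

Lemma solution_minimizer a b : solves_system k x y w a b ->
  unique (is_minimizer H ip x y w) (spanfun a b).
Proof.
move=> Sab; have Fh := solution_feasible Sab.
have quad_ge0 t : 0 <= \sum_(i < N) dotmx (t (x i) - spanfun a b (x i))
        (w i *m (t (x i) - spanfun a b (x i))).
  by apply: sumr_ge0 => i _; exact: posdefmx_dotmx_ge0.
have Hu t : feasible H t -> H (t - spanfun a b).
  by move=> [Ht _ _ _]; apply: (hilbertB HH) => //; exact: spanfun_H.
split.
  split=> // t Ft; rewrite (cost_feasible Sab Ft) -addrA lerDl addr_ge0 //.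
  exact/(hilbert_ip_ge0 HH)/Hu.
move=> t [Ft tmin]; apply/esym/eqP; rewrite -subr_eq0; apply/eqP.
apply: (hilbert_ip_eq0 HH (Hu t Ft)); apply/eqP.
rewrite eq_le (hilbert_ip_ge0 HH (Hu t Ft)) andbT.
have := tmin _ Fh; rewrite (cost_feasible Sab Ft) -addrA gerDl.
by apply: le_trans; rewrite lerDl.
Qed.

End Solution.

Theorem theorem4p1 (R : realType) (d m N : nat) (Omega : set 'cV[R]_d)
    (k : 'cV[R]_d -> 'cV[R]_d -> 'M[R]_m)
    (H : set ('cV[R]_d -> 'cV[R]_m))
    (ip : ('cV[R]_d -> 'cV[R]_m) -> ('cV[R]_d -> 'cV[R]_m) -> R)
    (x : 'I_N -> 'cV[R]_d) (y : 'I_N -> 'cV[R]_m) (w : 'I_N -> 'M[R]_m)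
    (Omega_open : open Omega) (Omega0 : Omega 0)
    (k_posdef : posdef_kernel Omega k)
    (k_C2 : class_C 2 (Omega `*` Omega)
              (fun p : 'cV[R]_d * 'cV[R]_d => k p.1 p.2))
    (H_native : native_space Omega k H ip)
    (x_Omega : forall i, Omega (x i))
    (w_posdef : forall i, posdefmx (w i)) :
  exists h : 'cV[R]_d -> 'cV[R]_m,
    [/\ unique (is_minimizer H ip x y w) h,
        exists (a : 'I_N.+1 -> 'cV[R]_m) (b : 'I_d -> 'cV[R]_m),
          forall z, Omega z -> h z = ansatz k x a b z,
        exists (a : 'I_N.+1 -> 'cV[R]_m) (b : 'I_d -> 'cV[R]_m),
          solves_system k x y w a b
      & forall (a : 'I_N.+1 -> 'cV[R]_m) (b : 'I_d -> 'cV[R]_m),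
          solves_system k x y w a b ->
          forall z, Omega z -> h z = ansatz k x a b z].
Proof.
have solP a b : solves_system k x y w a b ->
    unique (is_minimizer H ip x y w) (spanfun Omega k x a b).
  exact: solution_minimizer.
have [a [b Sab]] : exists a b, solves_system k x y w a b.
  exact: (system_solvable y Omega_open Omega0 k_C2 H_native x_Omega w_posdef).
have [min_h uniq_h] := solP a b Sab.
exists (spanfun Omega k x a b); split=> //.
- by exists a, b => z Oz; exact: spanfun_ansatz.
- by exists a, b.
move=> a' b' Sab' z Oz; rewrite (uniq_h _ (solP a' b' Sab').1).
exact: spanfun_ansatz.
Qed.
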